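(* Let $S$ be a $(d-1)$-dimensional smooth hypersurface in $\mathbb R^d$, let $\sigma$ be a probability measure on $S$, and let $v:S\to S^{d-1}$ be a measurable vector field with values in the unit sphere. For $p\ge2$ define $$J_p(v,\sigma)=\iint_{S\times S}|v(x)\wedge v(y)|^p\,d\sigma(x)\,d\sigma(y).$$ Then $$J_p(v,\sigma)\le1-\frac1d.$$ Moreover, equality holds if the push-forward measure $\mu=v_\#\sigma$ (i.e. $\mu(A)=\sigma(v^{-1}(A))$) is supported on the set $\{\pm e_1,\dots,\pm e_d\}$ for some orthonormal basis $\{e_i\}_{i=1}^d$ of $\mathbb R^d$ and satisfies $\mu(\{e_i\})+\mu(\{-e_i\})=1/d$ for all $i=1,\dots,d$.
   Context: $|a\wedge b|$ is the area of the parallelogram spanned by $a,b\in\mathbb R^d$; for unit vectors $|a\wedge b|^2=1-\langle a,b\rangle^2$. *)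

(* Defs.v *)
From HB Require Import structures.
From mathcomp Require Import all_boot all_order all_algebra.
From mathcomp Require Import all_classical all_reals all_analysis.
From mathcomp Require Import ring.

Set Implicit Arguments.
Unset Strict Implicit.
Unset Printing Implicit Defensive.

Import Order.TTheory GRing.Theory Num.Theory numFieldNormedType.Exports.

Local Open Scope classical_set_scope.
Local Open Scope ring_scope.

Section Euclidean.
Context {R : realType} {d : nat}.
Implicit Types a b : 'rV[R]_d.

Definition dot a b : R := \sum_(i < d) a 0 i * b 0 i.

(* The library norm [`|a|] on row vectors is the sup norm; it only enters
   below through the topology and the partial derivatives, where the choice of
   norm is irrelevant. *)
Definition enorm a : R := Num.sqrt (dot a a).

Definition unit_sphere : set 'rV[R]_d := [set a | enorm a = 1].

(* The area of the parallelogram spanned by two vectors is the square root of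
   their Gram determinant. *)
Definition wedge a b : R := Num.sqrt (dot a a * dot b b - dot a b ^+ 2).

Lemma dot_sqr a : enorm a ^+ 2 = dot a a.
Proof. by rewrite sqr_sqrtr// sumr_ge0// => i _; rewrite -expr2 sqr_ge0. Qed.

Lemma wedge_unit a b : unit_sphere a -> unit_sphere b ->
  wedge a b ^+ 2 = 1 - dot a b ^+ 2.
Proof.
rewrite /unit_sphere/= => a1 b1; move: (dot_sqr a) (dot_sqr b).
rewrite a1 b1 expr1n /wedge => <- <-; rewrite mul1r sqr_sqrtr//.
have -> : 1 - dot a b ^+ 2 = \sum_i (a 0 i - dot a b * b 0 i) ^+ 2.
  under eq_bigr => i _ do
    rewrite sqrrB exprMn mulrCA -mulrnAr -mulr_natr -!mulrA.
  rewrite !big_split/= sumrN -!mulr_sumr.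
  under eq_bigr => i _ do rewrite expr2.
  rewrite -[\sum_i _ * _]/(dot a a) -dot_sqr a1.
  have -> : \sum_i b 0 i ^+ 2 = 1.
    by rewrite -[RHS](expr1n _ 2) -b1 dot_sqr; apply: eq_bigr => i _; rewrite expr2.
  under eq_bigr => i _ do rewrite mulrA.
  rewrite -mulr_suml -/(dot a b); ring.
by rewrite sumr_ge0// => i _; rewrite sqr_ge0.
Qed.

Definition orthonormal_basis (e : 'I_d -> 'rV[R]_d) :=
  (forall i j, dot (e i) (e j) = (i == j)%:R) /\
  (forall x, exists c : 'I_d -> R, x = \sum_(i < d) c i *: e i).

End Euclidean.

Section Hypersurface.
Context {R : realType} {d : nat}.
Implicit Types (f : 'rV[R]_d -> R) (U S : set 'rV[R]_d).

Definition partial (i : 'I_d) f : 'rV[R]_d -> R :=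
  fun x => 'D_(delta_mx 0 i) f x.

Definition iter_partial (s : seq 'I_d) f : 'rV[R]_d -> R := foldr partial f s.

(* C^oo on an open set: partial derivatives of all orders exist and are
   continuous. *)
Definition smooth_on U f := forall (s : seq 'I_d) x, U x ->
  {for x, continuous (iter_partial s f)} /\
  forall i : 'I_d, derivable (iter_partial s f) x (delta_mx 0 i).

(* Embedded C^oo submanifold of codimension 1: locally the zero set of a smooth
   function with nowhere vanishing gradient. *)
Definition smooth_hypersurface S := forall x, S x ->
  exists (U : set 'rV[R]_d) (f : 'rV[R]_d -> R),
    [/\ open U, U x, smooth_on U f,
        (forall y, U y -> exists i : 'I_d, partial i f y != 0)
      & S `&` U = [set y | U y /\ f y = 0]].

End Hypersurface.

Definition borel (T : ptopologicalType) := g_sigma_algebraType (@open T).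

(* The type of points of [S], with the topology induced by the ambient space.
   The base point is only there because a [measurableType] is a [pointedType];
   a set carrying a probability measure is nonempty. *)
Definition pointed_subset (T : topologicalType) (S : set T) (x0 : S) : Type := S.

HB.instance Definition _ (T : topologicalType) (S : set T) (x0 : S) :=
  Topological.copy (pointed_subset x0) (set_type S).
HB.instance Definition _ (T : topologicalType) (S : set T) (x0 : S) :=
  isPointed.Build (pointed_subset x0) x0.

Section Energy.
Context {R : realType} {d : nat} {disp : measure_display}
  {X : measurableType disp}.

Definition J (p : R) (v : X -> 'rV[R]_d) (sigma : set X -> \bar R) : \bar R :=
  (\int[sigma \x sigma]_z ((wedge (v z.1) (v z.2)) `^ p)%:E)%E.

Definition supported_on (mu : set X -> \bar R) (A : set X) := mu (~` A) = 0%E.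

End Energy.

(* Main.v *)
(** With [M = \int v v^T dsigma], a positive matrix of trace [1], one has
    [\iint <v x, v y>^2 = |M|^2], and [|M|^2 >= 1 / d] by expanding
    [|M - I / d|^2 >= 0].  As [wedge <= 1], the exponent [p >= 2] can be lowered
    to [2], and [wedge^2 = 1 - <v x, v y>^2].  In the equality case, for almost
    every [x] the integrand [y |-> wedge (v x) (v y) `^ p] is almost everywhere
    the indicator of [v y <> +- v x], of measure [1 - 1 / d]. *)
Require Import Defs.
From HB Require Import structures.
From mathcomp Require Import all_boot all_order all_algebra.
From mathcomp Require Import all_classical all_reals all_analysis.
From mathcomp Require Import measurable_realfun ring.
Import Order.TTheory GRing.Theory Num.Theory numFieldNormedType.Exports.
Local Open Scope classical_set_scope.
Local Open Scope ring_scope.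

(** * Pointwise bounds for unit vectors *)

Section WedgeOfUnitVectors.
Context {R : realType} {d : nat}.
Implicit Types a b : 'rV[R]_d.

Lemma wedge_ge0 a b : 0 <= wedge a b.
Proof. exact: sqrtr_ge0. Qed.

Lemma wedge_le1 a b : unit_sphere a -> unit_sphere b -> wedge a b <= 1.
Proof.
move=> ha hb; rewrite -(@ler_pXn2r _ 2)// ?nnegrE ?wedge_ge0//.
by rewrite wedge_unit// expr1n gerBl sqr_ge0.
Qed.

Lemma dot_unit a : unit_sphere a -> dot a a = 1.
Proof. by move=> ha; rewrite -dot_sqr ha expr1n. Qed.

Lemma unit_coord_le1 a i : unit_sphere a -> `|a 0 i| <= 1.
Proof.
move=> ha; rewrite -(@ler_pXn2r _ 2)// ?nnegrE// expr1n real_normK ?num_real//.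
rewrite -(dot_unit _ ha) /dot (bigD1 i)//= -expr2 lerDl.
by apply: sumr_ge0 => j _; rewrite -expr2 sqr_ge0.
Qed.

Lemma wedge_powR_le a b (p : R) : unit_sphere a -> unit_sphere b -> 2 <= p ->
  wedge a b `^ p <= 1 - dot a b ^+ 2.
Proof.
move=> ha hb hp; rewrite -wedge_unit// -powR_mulrn ?wedge_ge0//.
(* Lowering the exponent needs a base in ]0, 1]. At base 0 both powers vanish because neither
   exponent is 0. *)
have := wedge_ge0 a b; rewrite le_eqVlt => /predU1P[<-|w0].
  by rewrite !powR0// gt_eqF// (lt_le_trans _ hp).
by rewrite ger_powR ?w0 ?wedge_le1.
Qed.

Lemma dotNl a b : dot (- a) b = - dot a b.
Proof.
by rewrite /dot -sumrN; apply: eq_bigr => i _; rewrite mxE mulNr.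
Qed.

Lemma dotNr a b : dot a (- b) = - dot a b.
Proof.
by rewrite /dot -sumrN; apply: eq_bigr => i _; rewrite mxE mulrN.
Qed.

End WedgeOfUnitVectors.

(** * Traceless second moments *)

Section SecondMoment.
Context {R : realType} {d : nat}.

(** For unit [a] this is an entry of the traceless matrix [a a^T - I / d]. Indexing by pairs turns
    the Frobenius product into a single sum. *)
Definition centered_moment (a : 'rV[R]_d) (k : 'I_d * 'I_d) : R :=
  a 0 k.1 * a 0 k.2 - (k.1 == k.2)%:R / d%:R.

(** In the Frobenius product, [a a^T] against [b b^T] gives the squared dot product, each against
    [I] gives its trace 1, and [I] against itself gives [d]. The correction is thus
    [- 1/d - 1/d + 1/d]. *)
Lemma sum_centered_moment (a b : 'rV[R]_d) : (0 < d)%N ->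
  unit_sphere a -> unit_sphere b ->
  \sum_k centered_moment a k * centered_moment b k = dot a b ^+ 2 - d%:R^-1.
Proof.
move=> d0 ha hb; have d0' : d%:R != 0 :> R by rewrite pnatr_eq0 -lt0n.
have sqdot (c : 'rV[R]_d) :
    unit_sphere c ->
    \sum_(k : 'I_d * 'I_d) (k.1 == k.2)%:R * (c 0 k.1 * c 0 k.2) = 1.
  move=> hc.
  rewrite -(pair_bigA _ (fun i j => (i == j)%:R * (c 0 i * c 0 j)))/=.
  rewrite -[RHS](dot_unit _ hc); apply: eq_bigr => i _.
  rewrite (bigD1 i)//= eqxx mulr1n mul1r big1 ?addr0// => j ji.
  by rewrite eq_sym (negbTE ji) mul0r.
have diag : \sum_(k : 'I_d * 'I_d) (k.1 == k.2)%:R = d%:R :> R.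
  rewrite -(pair_bigA _ (fun i j => (i == j)%:R))/=.
  rewrite (eq_bigr (fun _ => 1)) ?sumr_const ?card_ord// => i _.
  rewrite (bigD1 i)//= eqxx mulr1n big1 ?addr0// => j ji.
  by rewrite eq_sym (negbTE ji).
have -> : dot a b ^+ 2 =
    \sum_(k : 'I_d * 'I_d) (a 0 k.1 * a 0 k.2) * (b 0 k.1 * b 0 k.2).
  rewrite -(pair_bigA _ (fun i j => (a 0 i * a 0 j) * (b 0 i * b 0 j)))/=.
  rewrite expr2 {1}/dot mulr_suml; apply: eq_bigr => i _.
  by rewrite /dot mulr_sumr; apply: eq_bigr => j _; ring.
rewrite (eq_bigr (fun k => (a 0 k.1 * a 0 k.2) * (b 0 k.1 * b 0 k.2)
   + (- d%:R^-1) * ((k.1 == k.2)%:R * (a 0 k.1 * a 0 k.2))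
   + (- d%:R^-1) * ((k.1 == k.2)%:R * (b 0 k.1 * b 0 k.2))
   + d%:R^-2 * (k.1 == k.2)%:R)); last first.
  (* The case split uses that a Kronecker symbol equals its square. *)
  move=> k _; rewrite /centered_moment.
  by case: (k.1 == k.2) => /=; field.
by rewrite !big_split/= -!mulr_sumr !sqdot// diag; field.
Qed.

Lemma centered_moment_bound (a : 'rV[R]_d) k : unit_sphere a ->
  `|centered_moment a k| <= 2.
Proof.
move=> ha; rewrite (le_trans (ler_normB _ _))// (_ : 2 = 1 + 1)// lerD//.
  by rewrite normrM mulr_ile1 ?unit_coord_le1.
rewrite ger0_norm ?divr_ge0//; case: (_ == _); rewrite ?mul0r// mul1r.
(* The index [k] itself witnesses that [d] is positive. *)
rewrite invr_le1 ?ler1n; first by case: (k) => -[]; case: d.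
  by rewrite unitfE pnatr_eq0; case: (k) => -[]; case: d.
by rewrite ltr0n; case: (k) => -[]; case: d.
Qed.

End SecondMoment.

(** * Measurability, coordinate by coordinate, and Borel sets *)

Section Measurability.
Context {R : realType} {d : nat} {disp : measure_display}
  {X : measurableType disp}.

Lemma measurable_dot (u w : X -> 'rV[R]_d) :
  (forall i, measurable_fun setT (fun x => u x 0 i)) ->
  (forall i, measurable_fun setT (fun x => w x 0 i)) ->
  measurable_fun setT (fun x => dot (u x) (w x)).
Proof. by move=> mu mw; apply: measurable_sum => i; exact: measurable_funM. Qed.

Lemma measurable_wedge (u w : X -> 'rV[R]_d) :
  (forall i, measurable_fun setT (fun x => u x 0 i)) ->
  (forall i, measurable_fun setT (fun x => w x 0 i)) ->
  measurable_fun setT (fun x => wedge (u x) (w x)).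
Proof.
move=> mu mw; rewrite /wedge.
apply: (measurableT_comp (f := @Num.sqrt R)).
  exact: (continuous_measurable_fun (@sqrt_continuous R)).
apply: measurable_funB.
  by apply: measurable_funM; exact: measurable_dot.
by apply: measurable_funX; exact: measurable_dot.
Qed.

Lemma measurable_centered_moment (u : X -> 'rV[R]_d) k :
  (forall i, measurable_fun setT (fun x => u x 0 i)) ->
  measurable_fun setT (fun x => centered_moment (u x) k).
Proof. by move=> mu; apply: measurable_funB => //; exact: measurable_funM. Qed.

End Measurability.

(** Open intervals generate the Borel sets of the line, and their preimages are open, hence
    generators of [borel T]. *)
Lemma continuous_borel_measurable {R : realType} (T : ptopologicalType)
    (f : T -> R) : continuous f -> measurable_fun setT (f : borel T -> R).
Proof.
move=> /continuousP cf; apply: (measurability _ (RGenOpens.measurableE R)).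
move=> _ [_ [a [b ->] <-]]; rewrite setTI.
by apply: sub_sigma_algebra; exact/cf/interval_open.
Qed.

Lemma measurable_borel_set1 {R : realType} {d : nat} (a : 'rV[R]_d) :
  measurable ([set a] : set (borel 'rV[R]_d)).
Proof.
rewrite -[X in measurable X]setCK; apply: measurableC.
apply: sub_sigma_algebra; rewrite openC.
apply: accessible_closed_set1; apply: hausdorff_accessible.
exact: norm_hausdorff.
Qed.

(** * The energy as an iterated integral, and its upper bound *)

Section Energy.
Context {R : realType} {d : nat} {disp : measure_display}
  {X : measurableType disp} (sigma : probability X R).
Variables (v : X -> 'rV[R]_d) (hv : forall x, unit_sphere (v x)).
Hypothesis mv : forall i, measurable_fun setT (fun x => v x 0 i).

Lemma probability_bounded_integrable (f : X -> R) (M : R) :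
  measurable_fun setT f -> (forall x, `|f x| <= M) ->
  sigma.-integrable setT (EFin \o f).
Proof.
move=> mf fM; apply: measurable_bounded_integrable => //.
  by rewrite (le_lt_trans (probability_le1 _ _)) ?ltry.
exists M; split; first exact: num_real.
by move=> N /ltW MN x _; exact: le_trans (fM x) MN.
Qed.

Lemma integral_probability_cst (r : R) : (\int[sigma]_x r%:E = r%:E)%E.
Proof.
rewrite (integral_cst _ measurableT r%:E) (_ : (sigma : measure _ _) _ = 1%E).
  by rewrite mule1.
exact: probability_setT.
Qed.

(** Serves both variables of the double integral: the coefficients [c] are first moments at a fixed
    point, then integrated moments. *)
Lemma integral_cst_sub_sum (K : finType) (b : K -> X -> R) (c : K -> R)
    (r : R) :
  (forall k, sigma.-integrable setT (EFin \o b k)) ->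
  (\int[sigma]_x (r - \sum_k c k * b k x)%:E =
   (r - \sum_k c k * \int[sigma]_x b k x)%:E)%E.
Proof.
move=> ib.
have icb k : sigma.-integrable setT (fun x => (c k)%:E * (b k x)%:E)%E.
  by apply: integrableZl => //; exact: ib.
have icst : sigma.-integrable setT (EFin \o cst r).
  exact: (probability_bounded_integrable _ `|r|).
under eq_integral do rewrite EFinB.
rewrite integralB_EFin//; last first.
  rewrite (_ : _ \o _ = fun x => \sum_k ((c k)%:E * (b k x)%:E)%E); last first.
    by apply/funext => x /=; rewrite -sumEFin.
  exact: integrable_sum.
rewrite EFinB; congr (_ - _)%E; first exact: integral_probability_cst.
under eq_integral do rewrite -sumEFin.
rewrite integral_sum// -sumEFin; apply: eq_bigr => k _.
under eq_integral do rewrite EFinM.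
rewrite integralZl//; last exact: ib.
by rewrite EFinM /Rintegral fineK// integrable_fin_num//; exact: ib.
Qed.

Let mpair_fst i : measurable_fun setT (fun z : X * X => v z.1 0 i).
Proof. exact: (measurableT_comp (mv i) measurable_fst). Qed.

Let mpair_snd i : measurable_fun setT (fun z : X * X => v z.2 0 i).
Proof. exact: (measurableT_comp (mv i) measurable_snd). Qed.

Let mwedge_powR (p : R) :
  measurable_fun setT (fun z : X * X => (wedge (v z.1) (v z.2) `^ p)%:E).
Proof.
apply/measurable_EFinP; apply: (measurableT_comp (f := @powR R ^~ p)) => //.
exact: measurable_wedge.
Qed.

Lemma J_fubini (p : R) : J p v sigma =
  (\int[sigma]_x \int[sigma]_y (wedge (v x) (v y) `^ p)%:E)%E.
Proof.
rewrite /J (fubini_tonelli1 (m1 := sigma) (m2 := sigma)).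
- by [].
- exact: (mwedge_powR p).
- by move=> z; rewrite lee_fin powR_ge0.
Qed.

(** The subtracted sum is the squared Frobenius norm of [M - I / d]. It appears because the squared
    dot product, up to [1/d], is a sum of products of a function of [x] and the same function of
    [y]. *)
Lemma integral_wedge_sqr : (0 < d)%N ->
  (\int[sigma \x sigma]_z (1 - dot (v z.1) (v z.2) ^+ 2)%:E =
   (1 - d%:R^-1 - \sum_k (\int[sigma]_x centered_moment (v x) k) ^+ 2)%:E)%E.
Proof.
move=> d0.
rewrite (fubini_tonelli1 (m1 := sigma) (m2 := sigma))//=; last 2 first.
- apply/measurable_EFinP; apply: measurable_funB => //.
  by apply: measurable_funX; exact: measurable_dot.
- by move=> z; rewrite lee_fin -wedge_unit// exprn_ge0// wedge_ge0.
have im k : sigma.-integrable setT (EFin \o (fun x => centered_moment (v x) k)).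
  apply: (probability_bounded_integrable _ 2) => [|x].
    exact: measurable_centered_moment.
  exact: centered_moment_bound.
under eq_integral => x _.
  rewrite /fubini_F/=.
  under eq_integral => y _.
    rewrite (_ : 1 - _ = 1 - d%:R^-1 -
        \sum_k centered_moment (v x) k * centered_moment (v y) k); last first.
      by rewrite sum_centered_moment//; ring.
    over.
  rewrite integral_cst_sub_sum//.
  (* After the swap the inner integrals stand as coefficients for the outer integration. *)
  under eq_bigr do rewrite mulrC.
  over.
by rewrite integral_cst_sub_sum//; under eq_bigr do rewrite -expr2.
Qed.

Lemma J_le (p : R) : (0 < d)%N -> 2 <= p -> (J p v sigma <= (1 - d%:R^-1)%:E)%E.
Proof.
move=> d0 p2.
apply: (@le_trans _ _ (\int[sigma \x sigma]_z
    (1 - dot (v z.1) (v z.2) ^+ 2)%:E)%E); last first.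
  rewrite integral_wedge_sqr// lee_fin gerBl.
  by apply: sumr_ge0 => k _; exact: sqr_ge0.
apply: ge0_le_integral => //.
- by move=> z _; rewrite lee_fin powR_ge0.
- apply/measurable_EFinP; apply: measurable_funB => //.
  by apply: measurable_funX; exact: measurable_dot.
- by move=> z _; rewrite lee_fin wedge_powR_le.
Qed.

(** * The equality case *)

Lemma J_orthonormal (p : R) (e : 'I_d -> 'rV[R]_d) : (0 < d)%N -> p != 0 ->
  (forall i j, dot (e i) (e j) = (i == j)%:R) ->
  (forall i, measurable [set x | v x = e i]) ->
  (forall i, measurable [set x | v x = - e i]) ->
  sigma (~` [set x | exists i, v x = e i \/ v x = - e i]) = 0%E ->
  (forall i, sigma [set x | v x = e i] + sigma [set x | v x = (- e i)%R] =
     (d%:R^-1)%:E)%E ->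
  J p v sigma = (1 - d%:R^-1)%:E.
Proof.
move=> d0 p0 oe mp mn supp weight.
(* The wedge ignores signs, so opposite directions are grouped together. *)
pose E i := [set x | v x = e i] `|` [set x | v x = - e i].
have mE i : measurable (E i) by exact: measurableU.
have sE i : sigma (E i) = (d%:R^-1)%:E.
  rewrite -(weight i) measureU//; apply/seteqP; split => // x [/= -> h].
  (* Pairing [e i = - e i] with [e i] would give 1 = -1, so the union is disjoint and the masses
     add. *)
  move: (congr1 (dot (e i)) h); rewrite dotNr !oe eqxx => /eqP.
  by rewrite -subr_eq0 opprK (_ : 1 + 1 = 2%:R)// pnatr_eq0.
have ms : measurable [set x | exists i, v x = e i \/ v x = - e i].
  rewrite (_ : [set x | _] = \bigcup_(i in [set: 'I_d]) E i).
    by apply: fin_bigcup_measurable.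
  by apply/seteqP; split => x [i]; [exists i|exists i].
have wedge_E i j x y : E i x -> E j y -> wedge (v x) (v y) `^ p = (i != j)%:R.
  (* Powers fix 0 and 1; for 0 this needs [p != 0]. *)
  move=> hx hy; suff -> : wedge (v x) (v y) = (i != j)%:R.
    by case: (i != j); rewrite ?powR1// powR0.
  (* Squaring removes the signs, and nonnegativity allows taking the root back. *)
  have : wedge (v x) (v y) ^+ 2 = (i != j)%:R ^+ 2.
    rewrite wedge_unit// (_ : dot _ _ ^+ 2 = (i == j)%:R).
      by case: (i == j); rewrite ?subrr ?subr0 expr2 ?mul0r ?mulr1.
    case: hx => ->; case: hy => ->; rewrite ?dotNl ?dotNr ?sqrrN oe;
      by case: (i == j); rewrite expr2 ?mul0r ?mulr1.
  by move/eqP; rewrite eqrXn2 ?wedge_ge0// => /eqP.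
have ae_supp : {ae sigma, forall x, exists i, E i x}.
  exists (~` [set x | exists i, v x = e i \/ v x = - e i]); split => //.
  exact: measurableC.
have mw x : measurable_fun setT (fun y => (wedge (v x) (v y) `^ p)%:E).
  apply/measurable_EFinP; apply: (measurableT_comp (f := @powR R ^~ p)) => //.
  exact: measurable_wedge.
have inner i x : E i x ->
    (\int[sigma]_y (wedge (v x) (v y) `^ p)%:E = (1 - d%:R^-1)%:E)%E.
  (* The integrand is the indicator of the complement of [E i] only for [y] in some [E j], hence
     almost everywhere. *)
  move=> hx; transitivity (\int[sigma]_y (\1_(~` E i) y)%:E)%E.
    apply: ge0_ae_eq_integral => //.
    - by apply/measurable_EFinP; apply: measurable_indic; exact: measurableC.
    - by move=> y _; rewrite lee_fin powR_ge0.
    apply: filterS ae_supp => y [j hy] _; rewrite indicE.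
    have [hiy|niy] := pselect (E i y).
      by rewrite (wedge_E i i)// eqxx memNset//; apply.
    rewrite (wedge_E i j)// mem_set//.
    by rewrite (_ : i != j)//; apply/eqP => ij; apply: niy; rewrite ij.
  transitivity (sigma (~` E i)); last by rewrite probability_setC// sE EFinB.
  by rewrite integral_indic ?setIT//; exact: measurableC.
rewrite J_fubini.
transitivity (\int[sigma]_x (cst (1 - d%:R^-1)%:E x))%E; last first.
  exact: integral_probability_cst.
apply: ge0_ae_eq_integral => //.
(* Tonelli gives measurability of the inner integral as a function of [x]. *)
- apply: (measurable_fun_fubini_tonelli_F (m2 := sigma) _ (mwedge_powR p)).
  by move=> z; rewrite lee_fin powR_ge0.
- by move=> x _; apply: integral_ge0 => y _; rewrite lee_fin powR_ge0.
- by move=> x _; rewrite lee_fin subr_ge0 invf_le1 ?ler1n ?ltr0n.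
by apply: filterS ae_supp => x [i hx] _; exact: inner hx.
Qed.

End Energy.

Theorem theorem4p2 (R : realType) (d : nat) (hd : (0 < d)%N)
    (S : set 'rV[R]_d) (hS : smooth_hypersurface S) (x0 : S)
    (sigma : probability (borel (pointed_subset x0)) R)
    (v : borel (pointed_subset x0) -> borel 'rV[R]_d)
    (mv : measurable_fun setT v) (hv : forall x, unit_sphere (v x))
    (p : R) (hp : 2 <= p) :
  (J p v sigma <= (1 - d%:R^-1)%:E)%E /\
  (let mu := pushforward sigma v in
   forall e : 'I_d -> 'rV[R]_d, orthonormal_basis e ->
     supported_on mu [set x | exists i, x = e i \/ x = - e i] ->
     (forall i, (mu [set e i] + mu [set (- e i)%R] = (d%:R^-1)%:E)%E) ->
     J p v sigma = (1 - d%:R^-1)%:E).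
Proof.
have mc i : measurable_fun setT (fun x => (v x : 'rV[R]_d) 0 i).
  apply: (measurableT_comp
    (f := fun a : borel 'rV[R]_d => (a : 'rV[R]_d) 0 i)) => //.
  apply: (@continuous_borel_measurable R 'rV[R]_d).
  exact: coord_continuous.
(* Singletons are closed, hence Borel, so the level sets of [v] are measurable. *)
have mset1 a : measurable [set x | v x = a].
  rewrite -[X in measurable X]setTI.
  exact: (mv measurableT [set a] (measurable_borel_set1 a)).
split; first exact: J_le.
move=> mu e [oe _] supp weight.
(* [mu] of a set is by definition [sigma] of its preimage, so the hypotheses on [mu] are already
   statements about level sets of [v]. *)
apply: (J_orthonormal sigma v hv mc p e) => //.
by rewrite gt_eqF// (lt_le_trans _ hp).
Qed.
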